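(* Consider a discrete-time multi-agent system of $N$ identical agents $x_i(t+1)=Ax_i(t)+Bu_i(t)$, $y_i(t)=Cx_i(t)$ ($i=1,\dots,N$), with $x_i\in\mathbb{R}^n$, $u_i\in\mathbb{R}$, $y_i\in\mathbb{R}$. Each agent receives $$\zeta_i(t)=\sum_{j\ne i}d_{ij}(y_i(t)-y_j(t)),\qquad \hat\zeta_i(t)=\sum_{j\ne i}d_{ij}H_c(x_{i,c}(t)-x_{j,c}(t)),\qquad d_{ij}=\frac{a_{ij}}{1+q_i},$$ where $q_i\ge\sum_j a_{ij}$ is an upper bound on the weighted in-degree of node $i$, and uses a collaborative linear protocol $$x_{i,c}(t+1)=A_cx_{i,c}(t)+B_c\zeta_i(t)+E_c\hat\zeta_i(t),\qquad u_i(t)=F_cx_{i,c}(t)+G^1_c\zeta_i(t)+G^2_c\hat\zeta_i(t).$$ The scale-free collaborative state synchronization problem asks for fixed matrices $A_c,B_c,E_c,F_c,G_c^1,G_c^2,H_c$ (independent of $N$ and of the graph) such that for every number of agents $N$, every weighted directed graph on $N$ nodes containing a directed spanning tree, and all initial conditions of agents and protocols, $\lim_{t\to\infty}(x_i(t)-x_j(t))=0$ for all $i,j$. This problem is solvable if and only if either $A$ is asymptotically stable (Schur), or all of the following hold: $(A,B)$ is stabilizable, $(C,A)$ is detectable, and all eigenvalues of $A$ lie in the closed unit disc.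
   Context: The network is described by a weighted directed graph on nodes $\{1,\dots,N\}$ with weighted adjacency matrix $[a_{ij}]$, $a_{ij}\ge0$, $a_{ii}=0$, where $a_{ij}>0$ means an edge from node $j$ to node $i$. A directed spanning tree exists iff some node has a directed path to every other node. *)

(* Defs.v *)
From HB Require Import structures.
From mathcomp Require Import all_boot all_order all_algebra.
From mathcomp Require Import complex.
From mathcomp Require Import all_classical all_reals all_analysis.
Set Implicit Arguments. Unset Strict Implicit. Unset Printing Implicit Defensive.
Import Order.TTheory GRing.Theory Num.Theory numFieldNormedType.Exports.
Local Open Scope ring_scope.
Local Open Scope complex_scope.
Local Open Scope classical_set_scope.

Section Defs.
Variable R : realType.

Definition cmx (n : nat) (A : 'M[R]_n) : 'M[R[i]]_n := map_mx (fun x => x%:C) A.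

Definition schur (n : nat) (A : 'M[R]_n) : Prop :=
  forall l : R[i], eigenvalue (cmx A) l -> `|l| < 1.

Definition eig_closed_disc (n : nat) (A : 'M[R]_n) : Prop :=
  forall l : R[i], eigenvalue (cmx A) l -> `|l| <= 1.

Definition stabilizable (n m : nat) (A : 'M[R]_n) (B : 'M[R]_(n, m)) : Prop :=
  exists F : 'M[R]_(m, n), schur (A + B *m F).

Definition detectable (n p : nat) (C : 'M[R]_(p, n)) (A : 'M[R]_n) : Prop :=
  exists L : 'M[R]_(n, p), schur (A + L *m C).

(* weighted adjacency matrix: a i j >= 0, a i i = 0; a i j > 0 = edge j -> i *)
Definition weighted_adj (N : nat) (a : 'M[R]_N) : Prop :=
  (forall i j, 0 <= a i j) /\ (forall i, a i i = 0).

Definition has_spanning_tree (N : nat) (a : 'M[R]_N) : Prop :=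
  exists r : 'I_N, forall i : 'I_N, connect (fun j k : 'I_N => 0 < a k j) r i.

Definition indegree_bound (N : nat) (a : 'M[R]_N) (q : 'I_N -> R) : Prop :=
  forall i, \sum_j a i j <= q i.

Definition dcoef (N : nat) (a : 'M[R]_N) (q : 'I_N -> R) (i j : 'I_N) : R :=
  a i j / (1 + q i).

Definition closed_loop (n nc m N : nat)
  (A : 'M[R]_n) (B : 'M[R]_(n, 1)) (C : 'M[R]_(1, n))
  (Ac : 'M[R]_nc) (Bc : 'M[R]_(nc, 1)) (Ec : 'M[R]_(nc, m)) (Fc : 'M[R]_(1, nc))
  (G1 : 'M[R]_1) (G2 : 'M[R]_(1, m)) (Hc : 'M[R]_(m, nc))
  (a : 'M[R]_N) (q : 'I_N -> R)
  (x : nat -> 'I_N -> 'cV[R]_n) (xc : nat -> 'I_N -> 'cV[R]_nc) : Prop :=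
  forall (t : nat) (i : 'I_N),
    let zeta := \sum_(j | j != i) dcoef a q i j *: (C *m x t i - C *m x t j) in
    let zetah := \sum_(j | j != i) dcoef a q i j *: (Hc *m (xc t i - xc t j)) in
    let u := Fc *m xc t i + G1 *m zeta + G2 *m zetah in
    x t.+1 i = A *m x t i + B *m u /\
    xc t.+1 i = Ac *m xc t i + Bc *m zeta + Ec *m zetah.

Definition synchronized (n N : nat) (x : nat -> 'I_N -> 'cV[R]_n) : Prop :=
  forall (i j : 'I_N) (k : 'I_n), (fun t => (x t i - x t j) k 0) @ \oo --> 0.

Definition sf_collab_solvable (n : nat)
  (A : 'M[R]_n) (B : 'M[R]_(n, 1)) (C : 'M[R]_(1, n)) : Prop :=
  exists (nc m : nat) (Ac : 'M[R]_nc) (Bc : 'M[R]_(nc, 1)) (Ec : 'M[R]_(nc, m))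
    (Fc : 'M[R]_(1, nc)) (G1 : 'M[R]_1) (G2 : 'M[R]_(1, m)) (Hc : 'M[R]_(m, nc)),
  forall (N : nat) (a : 'M[R]_N) (q : 'I_N -> R),
    weighted_adj a -> has_spanning_tree a -> indegree_bound a q ->
    forall (x : nat -> 'I_N -> 'cV[R]_n) (xc : nat -> 'I_N -> 'cV[R]_nc),
      closed_loop A B C Ac Bc Ec Fc G1 G2 Hc a q x xc -> synchronized x.

End Defs.

(* Main.v *)
Require Import Defs.
From HB Require Import structures.
From mathcomp Require Import all_boot all_order all_algebra.
From mathcomp Require Import complex.
From mathcomp Require Import all_classical all_reals all_analysis.
From mathcomp Require Import ring lra.
Set Implicit Arguments. Unset Strict Implicit. Unset Printing Implicit Defensive.
Import Order.TTheory GRing.Theory Num.Theory numFieldNormedType.Exports.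
Local Open Scope ring_scope.
Local Open Scope classical_set_scope.
Import Normc.

(** Sufficiency. Each agent runs an observer [xh] of its relative state and a
    model [chi] of its own state fed by it, with input [u = F chi]. The observer
    error obeys the Schur matrix [A + L C]. The error [e = x - chi] obeys
    [e_i(t+1) = A (sum_j D_ij e_j(t)) + o(1)] with [D] row-stochastic; since the
    powers of [A] grow subexponentially and [D] contracts gaps, the gaps of [e]
    vanish, and they drive the differences of the [x_i] through the Schur matrix
    [A + B F]. Growth is never estimated: by Cayley-Hamilton the eigenvalues of
    [A] are peeled off one at a time, leaving scalar recursions.

    Necessity. With a leader and one follower coupled with gain [d], the state
    difference is the [x]-part of a trajectory of a matrix [M_d]. Unstable
    uncontrollable or unobservable modes of [A] survive in it, so both Hautus
    conditions hold. Feedback gains are then built by moving the unstable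
    eigenvalues to 0 one by one. If [A] had an eigenvalue [l] with [|l| > 1],
    the output from an eigenvector would tend pointwise to [l^t] as [d -> 0],
    while it is annihilated by a polynomial of fixed degree in the shift with
    all its roots in the unit disc: these are incompatible. *)

(** * Complex sequences tending to zero and perturbed contractions *)

Section VanishingSequences.
Variable R : realType.
Implicit Types (u v : nat -> R[i]) (s e : nat -> R).

Lemma normc_ge0 (z : R[i]) : 0 <= normc z.
Proof. by case: z => a b; exact: sqrtr_ge0. Qed.

Lemma normc_real (x : R) : normc x%:C%C = `|x|.
Proof. by rewrite /= expr0n addr0 sqrtr_sqr. Qed.

Lemma normcD (y z : R[i]) : normc (y + z) <= normc y + normc z.
Proof. exact: le_normcD. Qed.

Lemma normc_lt1 (z : R[i]) : (`|z| < 1) = (normc z < 1).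
Proof. exact: (ltcR (normc z) 1). Qed.

Lemma normc_le1 (z : R[i]) : (`|z| <= 1) = (normc z <= 1).
Proof. exact: (lecR (normc z) 1). Qed.

Lemma normcX (z : R[i]) t : normc (z ^+ t) = normc z ^+ t.
Proof.
elim: t => [|t IH]; first by rewrite !expr0 normc1.
by rewrite !exprS normcM IH.
Qed.

Lemma le_normc_sum (I : finType) (F : I -> R[i]) :
  normc (\sum_i F i) <= \sum_i normc (F i).
Proof.
elim/big_ind2: _ => [|x a y b xa yb|//]; first by rewrite normc0.
exact: le_trans (normcD _ _) (lerD xa yb).
Qed.

Definition vanishes u := (fun t => normc (u t)) @ \oo --> (0 : R).

Lemma vanishesP u : vanishes u <->
  forall eps : R, 0 < eps -> exists T, forall t, (T <= t)%N -> normc (u t) <= eps.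
Proof.
split=> [/cvgr0Pnorm_le u0 eps eps0|u0].
  have [T _ uT] := u0 eps eps0; exists T => t Tt.
  by have := uT t Tt; rewrite /= ger0_norm ?normc_ge0.
apply/cvgr0Pnorm_le => eps eps0; have [T uT] := u0 eps eps0.
by exists T => // t Tt; rewrite /= ger0_norm ?normc_ge0 ?uT.
Qed.

Lemma vanishes_le u s : (forall t, normc (u t) <= s t) -> s @ \oo --> (0 : R) ->
  vanishes u.
Proof.
move=> us s0; apply: (@squeeze_cvgr _ _ _ _ (fun=> 0) s) => //; last exact: cvg_cst.
by near=> t; rewrite normc_ge0 us.
Unshelve. all: by end_near. Qed.

Lemma vanishes0 : vanishes (fun=> 0).
Proof. by rewrite /vanishes normc0; exact: cvg_cst. Qed.

Lemma vanishesD u v : vanishes u -> vanishes v -> vanishes (fun t => u t + v t).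
Proof.
move=> u0 v0; apply: vanishes_le (fun t => normcD _ _) _.
by rewrite -[0]addr0; exact: cvgD.
Qed.

Lemma vanishesM (z : R[i]) u : vanishes u -> vanishes (fun t => z * u t).
Proof.
move=> u0; rewrite /vanishes; under eq_fun do rewrite normcM.
by rewrite -[0](mulr0 (normc z)); exact: cvgMr.
Qed.

Lemma vanishes_sum (I : finType) (U : I -> nat -> R[i]) :
  (forall i, vanishes (U i)) -> vanishes (fun t => \sum_i U i t).
Proof.
move=> U0; elim: (index_enum I) => [|i r IH].
  by under eq_fun do rewrite big_nil; exact: vanishes0.
by under eq_fun do rewrite big_cons; exact: vanishesD.
Qed.

Lemma vanishesS u : vanishes u -> vanishes (fun t => u t.+1).
Proof. by rewrite /vanishes => u0; rewrite -(cvg_shiftS (fun t => normc (u t))) in u0. Qed.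

Lemma vanishes_real (s : nat -> R) :
  vanishes (fun t => (s t)%:C%C) <-> s @ \oo --> (0 : R).
Proof.
by rewrite /vanishes; under eq_fun do rewrite normc_real; exact: norm_cvg0P.
Qed.

Lemma cvg0_of_contraction s e (rho : R) :
  0 <= rho < 1 -> (forall t, 0 <= s t) -> (forall t, s t.+1 <= rho * s t + e t) ->
  e @ \oo --> (0 : R) -> s @ \oo --> (0 : R).
Proof.
move=> /andP[rho0 rho1] s0 sS /cvgr0Pnorm_le e0; apply/cvgr0Pnorm_le => eps eps0.
(* With this bound on [e], the map [s -> rho * s + e] sends [eps / 2] to at most itself, so beyond
   [T] only the excess over [eps / 2] remains, and it decays like [rho ^+ m]. *)
have [T _ eT] := e0 (eps / 2 * (1 - rho)) ltac:(nra).
have sT m : s (T + m)%N <= rho ^+ m * s T + eps / 2.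
  elim: m => [|m IH]; first by rewrite addn0 expr0 mul1r; lra.
  rewrite addnS; apply: le_trans (sS _) _.
  have /= := eT (T + m)%N (leq_addr _ _); rewrite ler_norml => /andP[_ h].
  rewrite exprS; set r := rho ^+ m in IH *; set a := s (T + m)%N in IH *.
  have : rho * a <= rho * (r * s T + eps / 2) by exact: ler_wpM2l.
  by nra.
have : (fun m => s T * rho ^+ m) @ \oo --> (0 : R).
  by rewrite -[0](mulr0 (s T)); apply: cvgMr; apply: cvg_expr; rewrite ger0_norm.
move=> /cvgr0Pnorm_le /(_ (eps / 2)) [|M _ sM]; first by lra.
exists (T + M)%N => // t /= Tt; rewrite ger0_norm //.
rewrite -(subnKC (leq_trans (leq_addr M T) Tt)); apply: le_trans (sT _) _.
have /sM /= : (M <= t - T)%N by rewrite leq_subRL ?(leq_trans (leq_addr M T) Tt).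
by rewrite ler_norml => /andP[_]; lra.
Qed.

(** Along each residue class modulo [K] the sequence is a one-step contraction. There are finitely
    many classes, so their thresholds combine. *)
Lemma cvg0_of_contraction_steps s e (rho : R) K : (0 < K)%N ->
  0 <= rho < 1 -> (forall t, 0 <= s t) -> (forall t, s (t + K)%N <= rho * s t + e t) ->
  e @ \oo --> (0 : R) -> s @ \oo --> (0 : R).
Proof.
move=> K0 rho01 s0 sK /cvgr0Pnorm_le e0; apply/cvgr0Pnorm_le => eps eps0.
have sj (j : 'I_K) : exists M, forall m, (M <= m)%N -> s (j + m * K)%N <= eps.
  suff /cvgr0Pnorm_le/(_ _ eps0)[M _ sM] :
      (fun m => s (j + m * K)%N) @ \oo --> (0 : R).
    by exists M => m /sM /=; rewrite ger0_norm.
  apply: (@cvg0_of_contraction _ (fun m => e (j + m * K)%N) rho) => //.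
    by move=> m; rewrite mulSn addnCA addnC; exact: sK.
  apply/cvgr0Pnorm_le => d d0; have [T _ eT] := e0 d d0.
  exists T => // m /= Tm; apply: eT => /=.
  by rewrite (leq_trans Tm)// (leq_trans (leq_pmulr m K0))// leq_addl.
have [M sM] := choice sj.
exists ((\sum_j M j) * K)%N => // t /= Tt; rewrite ger0_norm //.
rewrite (divn_eq t K) addnC; apply: (sM (Ordinal (ltn_pmod t K0))) => /=.
by rewrite leq_divRL// (leq_trans _ Tt)// leq_mul2r (bigD1 (Ordinal (ltn_pmod t K0)))//= leq_addr orbT.
Qed.

End VanishingSequences.

(** * Peeling off eigenvalues by Cayley-Hamilton *)

Section SpectralCascade.
Variable R : realType.
Local Notation C := R[i].

Lemma char_poly_split n (M : 'M[C]_n) :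
  {s : seq C | char_poly M = \prod_(mu <- s) ('X - mu%:P)}.
Proof.
have [s Ms] := closed_field_poly_normal (char_poly M); exists s.
by rewrite {1}Ms (monicP (char_poly_monic M)) scale1r.
Qed.

Lemma eigenvalue_split n (M : 'M[C]_n) (s : seq C) mu :
  char_poly M = \prod_(mu <- s) ('X - mu%:P) -> eigenvalue M mu = (mu \in s).
Proof. by move=> Ms; rewrite eigenvalue_root_char Ms root_prod_XsubC. Qed.

Definition charprod n (M : 'M[C]_n) (s : seq C) : 'M[C]_n :=
  foldr (fun mu Q => (M - mu%:M) *m Q) 1%:M s.

Lemma charprod_eq0 n (M : 'M[C]_n) (s : seq C) :
  char_poly M = \prod_(mu <- s) ('X - mu%:P) -> charprod M s = 0.
Proof.
case: n M => [|n] M Ms; first exact: flatmx0.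
have := Cayley_Hamilton M; rewrite Ms => <-.
rewrite rmorph_prod /=; elim: s {Ms} => [|mu s IH]; first by rewrite big_nil.
by rewrite big_cons /= IH rmorphB /= horner_mx_X horner_mx_C.
Qed.

(** Induction on [s]: [Z (M - mu)] obeys the same recursion with forcing [W (M - mu)] and one factor
    fewer, so it satisfies [P]. Then [Z t.+1 - mu D Z t = D Z (M - mu) + W] satisfies [P], and the
    scalar hypothesis passes this on to [Z]. When [s] lists all eigenvalues, the final premise
    concerns the zero sequence. *)
Lemma cascade N n (D : 'M[C]_N) (M : 'M[C]_n) (P : (nat -> 'M[C]_(N, n)) -> Prop)
    (s : seq C) (Z W : nat -> 'M[C]_(N, n)) :
  (forall Y Y', P Y -> P Y' -> P (fun t => Y t + Y' t)) ->
  (forall Y Q, P Y -> P (fun t => Y t *m Q)) ->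
  (forall Y, P Y -> P (fun t => D *m Y t)) ->
  (forall mu, mu \in s -> forall Y,
     P (fun t => Y t.+1 - mu *: (D *m Y t)) -> P Y) ->
  (forall t, Z t.+1 = D *m Z t *m M + W t) -> P W ->
  P (fun t => Z t *m charprod M s) -> P Z.
Proof.
move=> PD PM PL; elim: s Z W => [|mu s IH] Z W Ps Zrec PW /= PZ.
  by move: PZ; under eq_fun do rewrite mulmx1.
apply: (Ps mu); first exact: mem_head.
have -> : (fun t => Z t.+1 - mu *: (D *m Z t)) =
          (fun t => D *m (Z t *m (M - mu%:M)) + W t).
  by apply/funext => t; rewrite Zrec mulmxBr mul_mx_scalar mulmxBr scalemxAr mulmxA addrAC.
apply: PD => //; apply: PL.
apply: (IH _ (fun t => W t *m (M - mu%:M))) (PM _ _ PW) _.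
- by move=> nu nus; apply: Ps; rewrite in_cons nus orbT.
- move=> t; rewrite Zrec mulmxDl -!mulmxA; congr (D *m (Z t *m _) + _).
  by rewrite mulmxBr mulmxBl scalar_mxC.
- by move: PZ; under eq_fun do rewrite mulmxA.
Qed.

Definition mx_vanishes m n (Z : nat -> 'M[C]_(m, n)) :=
  forall i j, vanishes (fun t => Z t i j).

Lemma mx_vanishesD m n (Y Z : nat -> 'M[C]_(m, n)) :
  mx_vanishes Y -> mx_vanishes Z -> mx_vanishes (fun t => Y t + Z t).
Proof.
by move=> Y0 Z0 i j; under eq_fun do rewrite mxE; exact: vanishesD.
Qed.

Lemma mx_vanishesMr m n p (Q : 'M[C]_(n, p)) (Z : nat -> 'M[C]_(m, n)) :
  mx_vanishes Z -> mx_vanishes (fun t => Z t *m Q).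
Proof.
move=> Z0 i j; under eq_fun do rewrite mxE.
apply: vanishes_sum => k; under eq_fun do rewrite mulrC.
exact: vanishesM.
Qed.

Lemma mx_vanishesMl m n p (Q : 'M[C]_(p, m)) (Z : nat -> 'M[C]_(m, n)) :
  mx_vanishes Z -> mx_vanishes (fun t => Q *m Z t).
Proof.
by move=> Z0 i j; under eq_fun do rewrite mxE; apply: vanishes_sum => k; exact: vanishesM.
Qed.

Lemma vanishes_scalar_iss (mu : C) (u : nat -> C) : normc mu < 1 ->
  vanishes (fun t => u t.+1 - mu * u t) -> vanishes u.
Proof.
move=> mu1; apply: (@cvg0_of_contraction _ _ _ (normc mu)).
- by rewrite normc_ge0.
- by move=> t; exact: normc_ge0.
- by move=> t; rewrite -normcM -{1}(subrK (mu * u t) (u t.+1)) addrC normcD.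
Qed.

(** The cascade with [D = 1]: each eigenvalue leaves a scalar contraction with vanishing
    disturbance. *)
Lemma vanishes_iss m n (M : 'M[C]_n) (Z W : nat -> 'M[C]_(m, n)) :
  (forall l, eigenvalue M l -> normc l < 1) ->
  (forall t, Z t.+1 = Z t *m M + W t) -> mx_vanishes W -> mx_vanishes Z.
Proof.
move=> M1 Zrec W0; have [s Ms] := char_poly_split M.
apply: (@cascade _ _ 1%:M M (@mx_vanishes m n) s Z W) => //.
- exact: mx_vanishesD.
- by move=> Y Q; exact: mx_vanishesMr.
- by move=> Y; exact: mx_vanishesMl.
- move=> mu; rewrite -(eigenvalue_split _ Ms) => /M1 mu1 Y Y0 i j.
  apply: (vanishes_scalar_iss mu1); have := Y0 i j.
  by under eq_fun do rewrite mul1mx 3!mxE.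
- by move=> t; rewrite mul1mx.
- by rewrite (charprod_eq0 Ms) => i j; under eq_fun do rewrite mulmx0 mxE; exact: vanishes0.
Qed.

Definition row_gaps_vanish N n (Y : nat -> 'M[C]_(N, n)) :=
  forall i j k, vanishes (fun t => Y t i k - Y t j k).

Lemma row_gaps_vanishD N n (Y Z : nat -> 'M[C]_(N, n)) :
  row_gaps_vanish Y -> row_gaps_vanish Z -> row_gaps_vanish (fun t => Y t + Z t).
Proof.
move=> Y0 Z0 i j k; under eq_fun do rewrite !mxE opprD addrACA.
exact: vanishesD.
Qed.

Lemma row_gaps_vanishMr N n p (Q : 'M[C]_(n, p)) (Y : nat -> 'M[C]_(N, n)) :
  row_gaps_vanish Y -> row_gaps_vanish (fun t => Y t *m Q).
Proof.
move=> Y0 i j k; under eq_fun do rewrite !mxE -sumrB.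
apply: vanishes_sum => l; under eq_fun do rewrite -mulrBl mulrC.
exact: vanishesM.
Qed.

End SpectralCascade.

(** * Row-stochastic matrices and consensus *)

Section StochasticMatrices.
Variable R : realType.
Local Notation C := R[i].
Local Notation toC := (real_complex R).

Definition stochastic N (D : 'M[R]_N) :=
  (forall i j, 0 <= D i j) /\ (forall i, \sum_j D i j = 1).

Lemma stochastic1 N : stochastic (1%:M : 'M[R]_N).
Proof.
split=> [i j|i]; first by rewrite mxE ler0n.
rewrite (bigD1 i)//= mxE eqxx big1 ?addr0// => j ji.
by rewrite mxE eq_sym (negPf ji).
Qed.

Lemma stochasticM N (D E : 'M[R]_N) :
  stochastic D -> stochastic E -> stochastic (D *m E).
Proof.
move=> [D0 D1] [E0 E1]; split=> [i j|i].
  by rewrite mxE sumr_ge0 // => k _; rewrite mulr_ge0.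
under eq_bigr do rewrite mxE.
rewrite exchange_big /=; under eq_bigr do rewrite -mulr_sumr E1 mulr1.
exact: D1.
Qed.

Lemma stochasticX N (D : 'M[R]_N) K : stochastic D -> stochastic (D ^+ K).
Proof.
move=> Ds; elim: K => [|K IH]; first exact: stochastic1.
by rewrite exprS; exact: stochasticM.
Qed.

Lemma mulmx_gt0 N (D E : 'M[R]_N) i k j : (forall i j, 0 <= D i j) ->
  (forall i j, 0 <= E i j) -> 0 < D i k -> 0 < E k j -> 0 < (D *m E) i j.
Proof.
move=> D0 E0 Dik Ekj; rewrite mxE (bigD1 k)//= ltr_pwDl ?mulr_gt0//.
by rewrite sumr_ge0// => l _; rewrite mulr_ge0.
Qed.

(** A path of length [k] from [r] to [i] makes [(D ^+ k) i r] positive, and the positive diagonal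
    lets walks wait, so all path lengths can be raised to a common [K]. *)
Lemma stochastic_column_gt0 N (D : 'M[R]_N) r : stochastic D ->
  (forall i, 0 < D i i) ->
  (forall i, connect (fun j k : 'I_N => 0 < D k j) r i) ->
  exists2 K, (0 < K)%N & forall i, 0 < (D ^+ K) i r.
Proof.
move=> Ds Dii Dr.
have Dpath p x : path (fun j k : 'I_N => 0 < D k j) x p ->
    0 < (D ^+ size p) (last x p) x.
  elim: p x => [|y p IH] x /=; first by rewrite expr0 mxE eqxx ltr01.
  move=> /andP[xy /IH yp]; rewrite exprSr; apply: mulmx_gt0 yp xy.
  - by case: (stochasticX (size p) Ds).
  - by case: Ds.
have Dmono i k m : 0 < (D ^+ k) i r -> 0 < (D ^+ (m + k)) i r.
  move=> Dk; elim: m => // m IH; rewrite addSn exprS; apply: mulmx_gt0 (Dii i) IH.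
  - by case: Ds.
  - by case: (stochasticX (m + k) Ds).
have Dk i : exists k, 0 < (D ^+ k) i r.
  by have /connectP[p /Dpath rp ->] := Dr i; exists (size p).
have [k Dki] := choice Dk.
exists (\sum_i k i).+1 => // i; rewrite (bigD1 i)//= addnC -addSn.
exact: Dmono.
Qed.

Definition osc N (y : 'I_N -> C) : R :=
  \big[Num.max/0]_(p : 'I_N * 'I_N) normc (y p.1 - y p.2).

Lemma le_osc N (y : 'I_N -> C) i j : normc (y i - y j) <= osc y.
Proof. exact: (le_bigmax _ _ (i, j)). Qed.

Lemma osc_ge0 N (y : 'I_N -> C) : 0 <= osc y.
Proof. exact: bigmax_ge_id. Qed.

Lemma osc_le N (y : 'I_N -> C) b : 0 <= b ->
  (forall i j, normc (y i - y j) <= b) -> osc y <= b.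
Proof. by move=> b0 yb; apply: bigmax_le. Qed.

(* Doeblin minorisation: after removing the common mass [eta] at [r], both rows
   have mass [1 - eta], and a coupling of them expresses the gap as an average
   of gaps of [y]. *)
Lemma osc_stochastic N (P : 'M[R]_N) r (eta : R) (y : 'I_N -> C) :
  stochastic P -> 0 < eta < 1 -> (forall i, eta <= P i r) ->
  osc (fun i => \sum_a toC (P i a) * y a) <= (1 - eta) * osc y.
Proof.
move=> [P0 P1] /andP[eta0 eta1] Pr.
apply: osc_le => [|i j]; first by rewrite mulr_ge0 ?osc_ge0// subr_ge0 ltW.
pose p i a := P i a - (if a == r then eta else 0).
have p0 l a : 0 <= p l a.
  by rewrite /p; case: eqP => [->|_]; rewrite ?subr0 ?subr_ge0.
have p1 l : \sum_a p l a = 1 - eta.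
  by rewrite sumrB P1 -big_mkcond big_pred1_eq.
have Pp l : \sum_a toC (P l a) * y a = \sum_a toC (p l a) * y a + toC eta * y r.
  rewrite [X in _ + X](_ : _ = \sum_a (if a == r then toC eta * y a else 0)).
    rewrite -big_split; apply: eq_bigr => a _ /=; rewrite /p.
    by case: eqP => _; rewrite ?subr0 ?addr0// rmorphB mulrBl subrK.
  by rewrite -big_mkcond big_pred1_eq.
rewrite !Pp opprD addrACA subrr addr0.
have m0 : 0 < 1 - eta by rewrite subr_gt0.
rewrite -(ler_pM2l m0) -{1}(ger0_norm (ltW m0)) -normc_real -normcM.
(* Each remainder has mass [1 - eta], so multiplying by that mass turns the difference of averages
   into a double sum over the product coupling. *)
have -> : toC (1 - eta) * (\sum_a toC (p i a) * y a - \sum_a toC (p j a) * y a) =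
    \sum_a \sum_b toC (p i a * p j b) * (y a - y b).
  have e l : toC (1 - eta) = \sum_b toC (p l b) by rewrite -(p1 l) rmorph_sum.
  rewrite mulrBr {1}(e j) (e i) [X in X - _]mulrC !big_distrlr /=.
  rewrite -sumrB; apply: eq_bigr => a _; rewrite -sumrB; apply: eq_bigr => b _.
  by rewrite rmorphM /=; ring.
apply: le_trans (le_normc_sum _) _.
rewrite mulrA -{1}(p1 i) -(p1 j) !mulr_suml; apply: ler_sum => a _.
rewrite mulr_sumr mulr_suml; apply: le_trans (le_normc_sum _) _.
apply: ler_sum => b _; rewrite normcM normc_real ger0_norm ?mulr_ge0//.
by rewrite ler_wpM2l ?mulr_ge0// le_osc.
Qed.

Lemma osc_cvg0 N (Y : nat -> 'I_N -> C) :
  (forall i j, vanishes (fun t => Y t i - Y t j)) ->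
  (fun t => osc (Y t)) @ \oo --> (0 : R).
Proof.
move=> Y0; apply/cvgr0Pnorm_le => eps eps0.
have Yp (p : 'I_N * 'I_N) :
    exists T, forall t, (T <= t)%N -> normc (Y t p.1 - Y t p.2) <= eps.
  by have /vanishesP := Y0 p.1 p.2; apply.
have [T YT] := choice Yp; exists (\sum_p T p)%N => // t /= Tt.
rewrite ger0_norm ?osc_ge0//; apply: osc_le (ltW eps0) _ => i j.
apply: (YT (i, j)); apply: leq_trans Tt.
by rewrite (bigD1 (i, j))//= leq_addr.
Qed.

(** Rows of [D] sum to 1, so after subtracting row [i] of [Y] every row of [D Y] is an average of
    gaps of [Y]. *)
Lemma row_gaps_vanish_stochastic N n (D : 'M[R]_N) (Y : nat -> 'M[C]_(N, n)) :
  stochastic D -> row_gaps_vanish Y ->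
  row_gaps_vanish (fun t => map_mx toC D *m Y t).
Proof.
move=> [D0 D1] Y0 i j k.
pose d (t : nat) l := \sum_b toC (D l b) * (Y t b k - Y t i k).
have dE t l : (map_mx toC D *m Y t) l k = d t l + Y t i k.
  rewrite mxE /d; under [X in _ = X + _]eq_bigr do rewrite mulrBr.
  rewrite sumrB -mulr_suml -rmorph_sum /= D1 mul1r subrK.
  by apply: eq_bigr => b _; rewrite mxE.
have -> : (fun t => (map_mx toC D *m Y t) i k - (map_mx toC D *m Y t) j k) =
    (fun t => d t i + (-1) * d t j).
  by apply/funext => t; rewrite !dE; ring.
have d0 l : vanishes (fun t => d t l).
  by apply: vanishes_sum => b; exact: vanishesM.
by apply: vanishesD => //; exact: vanishesM.
Qed.

(** Over [K] steps, [D ^+ K] has a positive column and shrinks the oscillation by [1 - eta], which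
    [normc mu <= 1] cannot undo. The disturbance accumulated meanwhile still has vanishing gaps. *)
Lemma stochastic_consensus N n (D : 'M[R]_N) r (mu : C) (Y : nat -> 'M[C]_(N, n)) :
  stochastic D -> (forall i, 0 < D i i) ->
  (forall i, connect (fun j k : 'I_N => 0 < D k j) r i) ->
  normc mu <= 1 ->
  row_gaps_vanish (fun t => Y t.+1 - mu *: (map_mx toC D *m Y t)) ->
  row_gaps_vanish Y.
Proof.
move=> Ds Dii Dr mu1 Ydyn.
have [K K0 DK] := stochastic_column_gt0 Ds Dii Dr.
have [eta eta01 etaP] : exists2 eta, 0 < eta < 1 & forall i, eta <= (D ^+ K) i r.
  (* Starting the minimum at [2^-1] keeps [eta] below 1 even if the whole column equals 1. *)
  exists (\big[Num.min/2^-1]_i (D ^+ K) i r).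
    apply/andP; split; first by apply/bigmin_gtP; split=> //; lra.
    by apply: (@le_lt_trans _ _ 2^-1); [exact: bigmin_le_id|lra].
  by move=> i; exact: bigmin_le_cond.
(* [V m] is the disturbance accumulated over [m] steps. *)
pose V m t := Y (t + m)%N - mu ^+ m *: (map_mx toC (D ^+ m) *m Y t).
have V0 m : row_gaps_vanish (V m).
  elim: m => [|m IH].
    have -> : V 0%N = (fun=> 0).
      apply/funext => t.
      by rewrite /V addn0 !expr0 scale1r map_mx1 mul1mx subrr.
    by move=> i j k; under eq_fun do rewrite !mxE subrr; exact: vanishes0.
  have -> : V m.+1 = (fun t =>
      (Y (t + m)%N.+1 - mu *: (map_mx toC D *m Y (t + m)%N)) +
      map_mx toC D *m V m t *m mu%:M).
    apply/funext => t; rewrite /V addnS mul_mx_scalar mulmxBr scalerBr addrA subrK.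
    by rewrite -scalemxAr scalerA -exprS mulmxA -map_mxM (exprS D).
  apply: row_gaps_vanishD; last first.
    by apply: row_gaps_vanishMr; exact: row_gaps_vanish_stochastic.
  move=> i j k; have /vanishesP Y0 := Ydyn i j k; apply/vanishesP => eps /Y0[T YT].
  by exists T => t Tt; apply: YT; rewrite (leq_trans Tt)// leq_addr.
move=> i j k.
have : (fun t => osc (fun i => Y t i k)) @ \oo --> (0 : R).
  apply: (@cvg0_of_contraction_steps _ _ (fun t => osc (fun i => V K t i k)) (1 - eta) K) => //.
  - by lra.
  - by move=> t; exact: osc_ge0.
  - move=> t; apply: osc_le => [|a b].
      by rewrite addr_ge0 ?mulr_ge0 ?osc_ge0//; lra.
    have YV c : Y (t + K)%N c k =
        mu ^+ K * (\sum_d toC ((D ^+ K) c d) * Y t d k) + V K t c k.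
      rewrite /V !mxE; under [X in _ - mu ^+ K * X]eq_bigr do rewrite mxE.
      by rewrite addrC subrK.
    rewrite !YV opprD addrACA -mulrBr.
    apply: le_trans (normcD _ _) _; apply: lerD; last exact: (le_osc (fun c => V K t c k)).
    rewrite normcM normcX.
    apply: le_trans (osc_stochastic _ (stochasticX K Ds) eta01 etaP).
    rewrite -[X in _ <= X]mul1r; apply: ler_pM; rewrite ?normc_ge0 ?exprn_ge0 ?normc_ge0//.
      by rewrite exprn_ile1// normc_ge0.
    exact: (le_osc (fun c => \sum_d toC ((D ^+ K) c d) * Y t d k)).
  - by apply: osc_cvg0 => a b; exact: V0.
by apply: vanishes_le => t; exact: (le_osc (fun i => Y t i k)).
Qed.

(** Eigenvalues on the unit circle are allowed here because the contraction comes from [D], not from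
    [M]. *)
Lemma stochastic_cascade N n (D : 'M[R]_N) r (M : 'M[C]_n)
    (Z W : nat -> 'M[C]_(N, n)) :
  stochastic D -> (forall i, 0 < D i i) ->
  (forall i, connect (fun j k : 'I_N => 0 < D k j) r i) ->
  (forall l, eigenvalue M l -> normc l <= 1) ->
  (forall t, Z t.+1 = map_mx toC D *m Z t *m M + W t) ->
  row_gaps_vanish W -> row_gaps_vanish Z.
Proof.
move=> Ds Dii Dr M1 Zrec W0; have [s Ms] := char_poly_split M.
apply: (@cascade _ _ _ (map_mx toC D) M (@row_gaps_vanish R N n) s Z W) => //.
- exact: row_gaps_vanishD.
- by move=> Y Q; exact: row_gaps_vanishMr.
- by move=> Y; exact: row_gaps_vanish_stochastic.
- move=> mu; rewrite -(eigenvalue_split _ Ms) => /M1 mu1 Y.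
  exact: (stochastic_consensus Ds Dii Dr mu1).
- rewrite (charprod_eq0 Ms) => i j k.
  by under eq_fun do rewrite mulmx0 !mxE subrr; exact: vanishes0.
Qed.

End StochasticMatrices.

(** * The protocol and its convergence *)

Section Sufficiency.
Variable R : realType.
Local Notation C := R[i].
Local Notation toC := (real_complex R).

Lemma eigenvalue_tr (F : fieldType) n (M : 'M[F]_n) l :
  eigenvalue M^T l = eigenvalue M l.
Proof.
rewrite !eigenvalue_root_char; congr (root _ l); rewrite /char_poly -[RHS]det_tr.
congr (\det _); apply/matrixP => i j.
by rewrite !mxE [j == i]eq_sym.
Qed.

Lemma schurP n (A : 'M[R]_n) :
  schur A <-> forall l, eigenvalue (map_mx toC A) l -> normc l < 1.
Proof. by split=> As l /As; rewrite normc_lt1. Qed.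

Lemma eig_closed_discP n (A : 'M[R]_n) :
  eig_closed_disc A <-> forall l, eigenvalue (map_mx toC A) l -> normc l <= 1.
Proof. by split=> As l /As; rewrite normc_le1. Qed.

Lemma schur_iss n (A : 'M[R]_n) (x w : nat -> 'cV[R]_n) : schur A ->
  (forall t, x t.+1 = A *m x t + w t) ->
  (forall k, (fun t => w t k 0) @ \oo --> (0 : R)) ->
  forall k, (fun t => x t k 0) @ \oo --> (0 : R).
Proof.
move=> /schurP As xrec w0 k; apply/vanishes_real.
(* States become rows, since the cascade multiplies by [M] on the right. *)
pose Z (t : nat) := map_mx toC (x t)^T; pose W (t : nat) := map_mx toC (w t)^T.
have : mx_vanishes Z.
  apply: (@vanishes_iss _ _ _ (map_mx toC A)^T Z W).
  - by move=> l; rewrite eigenvalue_tr; exact: As.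
  - by move=> t; rewrite /Z xrec raddfD /= map_mxD trmx_mul map_mxM map_trmx.
  - move=> i j; rewrite (ord1 i); under eq_fun do rewrite /W !mxE.
    exact/vanishes_real.
by move=> /(_ 0 k); under eq_fun do rewrite !mxE.
Qed.

Lemma consensus_iss N n (D : 'M[R]_N) r (A : 'M[R]_n)
    (e w : nat -> 'I_N -> 'cV[R]_n) :
  stochastic D -> (forall i, 0 < D i i) ->
  (forall i, connect (fun j k : 'I_N => 0 < D k j) r i) -> eig_closed_disc A ->
  (forall t i, e t.+1 i = A *m (\sum_j D i j *: e t j) + w t i) ->
  (forall i k, (fun t => w t i k 0) @ \oo --> (0 : R)) ->
  forall i j k, (fun t => (e t i - e t j) k 0) @ \oo --> (0 : R).
Proof.
move=> Ds Dii Dr /eig_closed_discP As erec w0 i j k; apply/vanishes_real.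
pose Z (t : nat) := \matrix_(i < N, k < n) toC (e t i k 0).
pose W (t : nat) := \matrix_(i < N, k < n) toC (w t i k 0).
have : row_gaps_vanish Z.
  apply: (@stochastic_cascade _ _ _ D r (map_mx toC A)^T Z W Ds Dii Dr).
  - by move=> l; rewrite eigenvalue_tr; exact: As.
  - move=> t; apply/matrixP => a b; rewrite 3!mxE erec 2!mxE rmorphD rmorph_sum /=.
    rewrite [W t a b]mxE; congr (_ + _).
    apply: eq_bigr => c _; rewrite summxE rmorphM rmorph_sum /= !mxE mulrC.
    congr (_ * _); apply: eq_bigr => d _.
    by rewrite !mxE rmorphM.
  - move=> a b c; under eq_fun do rewrite !mxE -rmorphB /=.
    apply/vanishes_real; have := cvgB (w0 a c) (w0 b c); rewrite subr0.
    by apply.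
by move=> /(_ i j k); under eq_fun do rewrite !mxE -rmorphB /=; under [in X in _ -> X]eq_fun do rewrite !mxE.
Qed.

(** The identity minus the normalised graph Laplacian. The 1 in the denominator [1 + q i] keeps its
    diagonal positive. *)
Definition averaging N (a : 'M[R]_N) (q : 'I_N -> R) : 'M[R]_N :=
  \matrix_(i, j) if j == i then 1 - \sum_(l | l != i) dcoef a q i l else dcoef a q i j.

Section Averaging.
Variables (N : nat) (a : 'M[R]_N) (q : 'I_N -> R).
Hypotheses (aw : weighted_adj a) (aq : indegree_bound a q).

Lemma indegree_bound_ge0 i : 0 <= q i.
Proof. by apply: le_trans (aq i); rewrite sumr_ge0// => j _; case: aw. Qed.

Lemma dcoef_ge0 i j : 0 <= dcoef a q i j.
Proof.
rewrite divr_ge0//; first by case: aw.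
by rewrite addr_ge0 ?ler01 ?indegree_bound_ge0.
Qed.

Lemma averaging_diag_gt0 i : 0 < averaging a q i i.
Proof.
have q0 := indegree_bound_ge0 i; rewrite mxE eqxx subr_gt0 -mulr_suml.
rewrite ltr_pdivrMr ?mul1r; last by lra.
apply: (@le_lt_trans _ _ (q i)); last by lra.
apply: le_trans (aq i); rewrite [leRHS](bigD1 i)//= lerDr.
by case: aw.
Qed.

Lemma averaging_stochastic : stochastic (averaging a q).
Proof.
split=> [i j|i].
  have [<-|ji] := eqVneq i j; first exact: ltW (averaging_diag_gt0 i).
  by rewrite mxE eq_sym (negPf ji) dcoef_ge0.
rewrite (bigD1 i)//= mxE eqxx.
by under [X in _ + X]eq_bigr => j ji do rewrite mxE (negPf ji); rewrite subrK.
Qed.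

Lemma averaging_connect r :
  (forall i : 'I_N, connect (fun j k : 'I_N => 0 < a k j) r i) ->
  forall i, connect (fun j k : 'I_N => 0 < averaging a q k j) r i.
Proof.
move=> ar i; apply: (connect_sub _ (ar i)) => j k ajk; apply: connect1.
have [->|jk] := eqVneq j k; first exact: averaging_diag_gt0.
rewrite mxE (negPf jk) divr_gt0//.
by have := indegree_bound_ge0 k; lra.
Qed.

Lemma coupling_averaging n (f : 'I_N -> 'cV[R]_n) i :
  \sum_(j | j != i) dcoef a q i j *: (f i - f j) =
  f i - \sum_j averaging a q i j *: f j.
Proof.
rewrite (bigD1 i (P := xpredT))//= mxE eqxx scalerBl scale1r.
rewrite opprD opprB addrA [f i + _]addrC subrK scaler_suml -sumrB.
by apply: eq_bigr => j ji; rewrite mxE (negPf ji) scalerBr.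
Qed.

End Averaging.

Theorem solvable_of_stabilizable_detectable n
    (A : 'M[R]_n) (B : 'M[R]_(n, 1)) (C : 'M[R]_(1, n)) :
  stabilizable A B -> detectable C A -> eig_closed_disc A ->
  sf_collab_solvable A B C.
Proof.
move=> [F AF] [L AL] A1.
(* The protocol state stacks [xh], an estimate of the agent's weighted gap to its neighbours, over
   [chi]. Only [chi] is exchanged, through [Hc]. *)
pose Ac : 'M[R]_(n + n) := block_mx (A + L *m C) 0 A (A + B *m F).
pose Bc : 'M[R]_(n + n, 1) := col_mx (- L) 0.
pose Ec : 'M[R]_(n + n, n) := col_mx (B *m F) (- A).
pose Fc : 'M[R]_(1, n + n) := row_mx 0 F.
pose Hc : 'M[R]_(n, n + n) := row_mx 0 1%:M.
exists (n + n)%N, n, Ac, Bc, Ec, Fc, 0, 0, Hc.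
move=> N a q aw [r ar] aq x xc dyn.
pose D := averaging a q.
pose xh t i := usubmx (xc t i); pose chi t i := dsubmx (xc t i).
have xcE t i : xc t i = col_mx (xh t i) (chi t i) by rewrite vsubmxK.
pose gap (f : 'I_N -> 'cV[R]_n) i := \sum_(j | j != i) dcoef a q i j *: (f i - f j).
have gapE f i : gap f i = f i - \sum_j D i j *: f j by exact: coupling_averaging.
have gapM m (Q : 'M[R]_(m, n)) f i :
    \sum_(j | j != i) dcoef a q i j *: (Q *m f i - Q *m f j) = Q *m gap f i.
  by rewrite mulmx_sumr; apply: eq_bigr => j _; rewrite -scalemxAr mulmxBr.
have {}dyn t i :
    [/\ x t.+1 i = A *m x t i + B *m F *m chi t i,
        xh t.+1 i = (A + L *m C) *m xh t i - L *m C *m gap (x t) i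
                    + B *m F *m gap (chi t) i &
        chi t.+1 i = A *m xh t i + (A + B *m F) *m chi t i - A *m gap (chi t) i].
  have [] := dyn t i; rewrite gapM.
  have -> : \sum_(j | j != i) dcoef a q i j *: (Hc *m (xc t i - xc t j))
      = gap (chi t) i.
    apply: eq_bigr => j _; congr (_ *: _).
    by rewrite mulmxBr !xcE !mul_row_col !mul0mx !add0r !mul1mx.
  rewrite !mul0mx !addr0 xcE => -> xcS; split.
  - by rewrite mul_row_col mul0mx add0r mulmxA.
  - rewrite /xh xcS mul_block_col !mul_col_mx !mul0mx !add_col_mx col_mxKu.
    by rewrite addr0 mulNmx mulmxA.
  - rewrite /chi xcS mul_block_col !mul_col_mx !mul0mx !add_col_mx col_mxKd.
    by rewrite addr0 mulNmx.
pose w t i := xh t i - gap (x t) i; pose e t i := x t i - chi t i.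
(* The gap of [x] is driven by [B F] times the gap of [chi], which the observer receives, so this
   input cancels in [w]. *)
have wS t i : w t.+1 i = (A + L *m C) *m w t i + 0.
  have [_ xhS _] := dyn t i.
  have gS : gap (x t.+1) i = A *m gap (x t) i + B *m F *m gap (chi t) i.
    rewrite -!gapM -big_split /=; apply: eq_bigr => j _.
    have [-> _ _] := dyn t i; have [-> _ _] := dyn t j.
    by rewrite -scalerDr opprD addrACA.
  rewrite addr0 /w xhS gS mulmxBr !mulmxDl.
  move: (A *m xh t i) (A *m gap (x t) i) (L *m C *m xh t i) (L *m C *m gap (x t) i).
  move: (B *m F *m gap (chi t) i) => X1 X2 X3 X4 X5.
  by apply/matrixP => u v; rewrite !mxE; ring.
have w0 i k : (fun t => w t i k 0) @ \oo --> (0 : R).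
  apply: (@schur_iss _ _ (fun t => w t i) (fun=> 0) AL) => // l.
  by under eq_fun do rewrite mxE; exact: cvg_cst.
(* Substituting [xh = w + gap x] makes [A e - A (gap e)] appear, and [e - gap e] is the average
   under [D]. *)
have eS t i : e t.+1 i = A *m (\sum_j D i j *: e t j) + - A *m w t i.
  have -> : \sum_j D i j *: e t j = \sum_j D i j *: x t j - \sum_j D i j *: chi t j.
    by rewrite -sumrB; apply: eq_bigr => j _; rewrite -scalerBr.
  have [xS _ chiS] := dyn t i; rewrite /e xS chiS /w !gapE mulmxDl mulNmx !mulmxBr.
  move: (A *m x t i) (B *m F *m chi t i) (A *m xh t i) (A *m chi t i).
  move: (A *m \sum_j D i j *: x t j) (A *m \sum_j D i j *: chi t j).
  by move=> X1 X2 X3 X4 X5 X6; apply/matrixP => u v; rewrite !mxE; ring.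
have e0 := consensus_iss (averaging_stochastic aw aq) (averaging_diag_gt0 aw aq)
  (averaging_connect aw aq ar) A1 eS.
have {}e0 i j k : (fun t => (e t i - e t j) k 0) @ \oo --> (0 : R).
  apply: e0 => l m; under eq_fun do rewrite mxE.
  have : mx_vanishes (fun t => map_mx toC (- A *m w t l)).
    have -> : (fun t => map_mx toC (- A *m w t l)) =
        (fun t => map_mx toC (- A) *m map_mx toC (w t l)).
      by apply/funext => t; rewrite map_mxM.
    apply: mx_vanishesMl => b c; rewrite (ord1 c); under eq_fun do rewrite mxE.
    by apply/vanishes_real.
  by move=> /(_ m 0); under eq_fun do rewrite mxE; move=> /vanishes_real; under eq_fun do rewrite mxE.
move=> i j k.
(* As [chi = x - e], each agent obeys [x t.+1 = (A + B F) x - B F e]. *)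
apply: (@schur_iss _ _ (fun t => x t i - x t j)
          (fun t => - (B *m F) *m (e t i - e t j)) AF) => [t|l].
  have [-> _ _] := dyn t i; have [-> _ _] := dyn t j; rewrite /e.
  by rewrite mulNmx mulmxDl !mulmxBr; apply/matrixP => u v; rewrite !mxE; ring.
have : mx_vanishes (fun t => map_mx toC (- (B *m F)) *m map_mx toC (e t i - e t j)).
  apply: mx_vanishesMl => b c; rewrite (ord1 c); under eq_fun do rewrite mxE.
  by apply/vanishes_real.
move=> /(_ l 0); under eq_fun do rewrite -map_mxM mxE.
by move=> /vanishes_real.
Qed.

End Sufficiency.

(** * From the Hautus test to real stabilizing gains *)

Section Stabilization.
Variable R : realType.
Local Notation C := R[i].
Local Notation toC := (real_complex R).

(** The bordered matrix [T] has determinant [\det (M + B *m F)] by eliminating [B]. Multiplying it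
    by a lower triangular matrix built from [\adj M] makes it upper triangular, and a factor
    [\det M] cancels. *)
Lemma det_rank1_update (K : idomainType) n (M : 'M[K]_n) (B : 'cV[K]_n) (F : 'rV[K]_n) :
  \det M != 0 -> \det (M + B *m F) = \det M + (F *m \adj M *m B) 0 0.
Proof.
move=> M0; apply: (mulIf M0).
pose T := block_mx (1%:M : 'M[K]_1) (- F) B M.
have T1 : \det T = \det (M + B *m F).
  have -> : T = block_mx 1%:M 0 B 1%:M *m block_mx 1%:M (- F) 0 (M + B *m F).
    rewrite mulmx_block !mul1mx !mul0mx !mulmx1 !addr0 mulmxN addrCA.
    by rewrite addNr addr0.
  by rewrite det_mulmx det_lblock det_ublock !det1 !mul1r.
rewrite -T1; have := det_mulmx T (block_mx (\det M)%:M 0 (- (\adj M *m B)) 1%:M).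
rewrite det_lblock det1 mulr1 det_scalar1 => <-.
rewrite mulmx_block !mul1mx !mulmx0 !mulmx1 !add0r mulmxN mulNmx opprK.
rewrite mulmxN [M *m _]mulmxA mul_mx_adj scalar_mxC subrr det_ublock det_mx11.
by rewrite mulmxA mxE [_%:M _ _]mxE eqxx mulr1n.
Qed.

Lemma char_poly_feedback n (A : 'M[C]_n) (B : 'cV[C]_n) (F : 'rV[C]_n) :
  char_poly (A + B *m F) = char_poly A -
    (map_mx polyC F *m \adj (char_poly_mx A) *m map_mx polyC B) 0 0.
Proof.
have -> : char_poly (A + B *m F) =
    \det (char_poly_mx A + map_mx polyC B *m - map_mx polyC F).
  by rewrite /char_poly /char_poly_mx map_mxD map_mxM mulmxN opprD addrA.
have M0 : \det (char_poly_mx A) != 0 by exact: monic_neq0 (char_poly_monic A).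
by rewrite (det_rank1_update _ _ M0) !mulNmx; congr (_ + _); rewrite mxE.
Qed.

(** Feedback along a left eigenvector moves only its own eigenvalue: [p (X - A) = (X - r) p] gives
    [(X - r) p \adj (X - A) = char_poly A p]. Keeping the factor [X - r] on the left avoids dividing
    polynomials. *)
Lemma char_poly_shift n (A : 'M[C]_n) (B : 'cV[C]_n) (p : 'rV[C]_n) (r c : C) :
  p *m A = r *: p ->
  ('X - r%:P) * char_poly (A + B *m (c *: p)) =
  ('X - (r + c * (p *m B) 0 0)%:P) * char_poly A.
Proof.
move=> pA; set pP := map_mx polyC p; set M := char_poly_mx A.
have pM : pP *m M = ('X - r%:P) *: pP.
  rewrite /M /char_poly_mx mulmxBr mul_mx_scalar -map_mxM pA map_mxZ.
  by rewrite scalerBl.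
have padj : ('X - r%:P) *: (pP *m \adj M) = char_poly A *: pP.
  by rewrite scalemxAl -pM -mulmxA mul_mx_adj mul_mx_scalar.
have : ('X - r%:P) * (map_mx polyC (c *: p) *m \adj M *m map_mx polyC B) 0 0 =
    char_poly A * (c * (p *m B) 0 0)%:P.
  rewrite map_mxZ -!scalemxAl mxE mulrCA.
  have -> : ('X - r%:P) * (pP *m \adj M *m map_mx polyC B) 0 0 =
      (('X - r%:P) *: (pP *m \adj M) *m map_mx polyC B) 0 0.
    by rewrite -scalemxAl [RHS]mxE.
  rewrite padj -scalemxAl [X in _ * X]mxE -map_mxM [map_mx _ _ _ _]mxE polyCM.
  by rewrite mulrCA.
by rewrite char_poly_feedback -/M mulrBr => ->; rewrite polyCD; ring.
Qed.

(** The Popov-Belevitch-Hautus test on left eigenvectors, restricted to modes outside the open unit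
    disc. *)
Definition hautus n m (A : 'M[C]_n) (B : 'M[C]_(n, m)) :=
  forall (l : C) (p : 'rV[C]_n), 1 <= normc l -> p *m A = l *: p -> p *m B = 0 -> p = 0.

Lemma hautus_feedback n m (A : 'M[C]_n) (B : 'M[C]_(n, m)) F :
  hautus A B -> hautus (A + B *m F) B.
Proof.
move=> hAB l p l1 pA pB; apply: (hAB l p l1) => //.
by rewrite -pA mulmxDr mulmxA pB mul0mx addr0.
Qed.

Definition clip (r : C) : C := if normc r < 1 then r else 0.

(** Induction on the eigenvalues still to treat, with [g] collecting those already settled. Feedback
    preserves the Hautus test, so successive gains can be added. *)
Lemma hautus_assign n (A : 'M[C]_n) (B : 'cV[C]_n) (s : seq C) (g : {poly C}) :
  hautus A B -> char_poly A = g * \prod_(r <- s) ('X - r%:P) ->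
  exists F, char_poly (A + B *m F) = g * \prod_(r <- s) ('X - (clip r)%:P).
Proof.
elim: s A g => [|r s IH] A g hAB As.
  by exists 0; rewrite mulmx0 addr0 As !big_nil.
rewrite big_cons in As; rewrite big_cons /clip.
have [r1|r1] := ltP (normc r) 1.
  by have [F AF] := IH A (g * ('X - r%:P)) hAB ltac:(by rewrite As mulrA); exists F; rewrite AF mulrA.
have /eigenvalueP[p pA p0] : eigenvalue A r.
  by rewrite eigenvalue_root_char As rootE !hornerM hornerXsubC subrr mul0r mulr0.
have pB : (p *m B) 0 0 != 0.
  apply: contra p0 => /eqP pB0; apply/eqP/(hAB r) => //.
  by apply/matrixP => i j; rewrite !ord1 pB0 mxE.
(* This [c] solves [r + c (p B) = 0], sending the eigenvalue to 0. *)
pose c := - r / (p *m B) 0 0.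
have A's : char_poly (A + B *m (c *: p)) = (g * 'X) * \prod_(r <- s) ('X - r%:P).
  have Xr0 : 'X - r%:P != 0 by rewrite polyXsubC_eq0.
  apply: (mulfI Xr0).
  by rewrite (char_poly_shift _ _ pA) /c divfK// subrr subr0 As; ring.
have [F AF] := IH _ _ (@hautus_feedback _ _ _ _ (c *: p) hAB) A's.
by exists (c *: p + F); rewrite mulmxDr addrA AF subr0 mulrA.
Qed.

Lemma normc_conj (z : C) : normc (conjc z) = normc z.
Proof. by case: z => a b /=; rewrite sqrrN. Qed.

Lemma clip_conj (z : C) : clip (conjc z) = conjc (clip z).
Proof. by rewrite /clip normc_conj; case: ifP => _; rewrite ?rmorph0. Qed.

Lemma map_conj_real m n (A : 'M[R]_(m, n)) : map_mx conjc (map_mx toC A) = map_mx toC A.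
Proof. by apply/matrixP => i j; rewrite !mxE conjc_real. Qed.

(* The characteristic polynomial of [A + B F] is affine in [F], so if it has real
   coefficients then the real part of [F] yields the same polynomial. *)
Lemma char_poly_real_feedback n (A : 'M[R]_n) (B : 'cV[R]_n) (F : 'rV[C]_n) :
  let chi := char_poly (map_mx toC A + map_mx toC B *m F) in
  map_poly conjc chi = chi ->
  char_poly (map_mx toC (A + B *m map_mx (@complex.Re R) F)) = chi.
Proof.
move=> chi chiJ.
have chiF : char_poly (map_mx toC A + map_mx toC B *m map_mx conjc F) = chi.
  by rewrite -[RHS]chiJ map_char_poly map_mxD map_mxM !map_conj_real.
have ReF : map_mx toC (map_mx (@complex.Re R) F) = 2^-1 *: F + 2^-1 *: map_mx conjc F.
  apply/matrixP => i j; rewrite !mxE -mulrDr mulrC; exact: ReJ_add.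
rewrite map_mxD map_mxM ReF char_poly_feedback.
have addE (U V : 'M[{poly C}]_1) : (U + V) 0 0 = U 0 0 + V 0 0 by rewrite mxE.
have scaleE b (U : 'M[{poly C}]_1) : (b *: U) 0 0 = b * U 0 0 by rewrite mxE.
move: chiF; rewrite /chi !char_poly_feedback map_mxD !map_mxZ !mulmxDl.
rewrite -!scalemxAl addE !scaleE => /addrI/oppr_inj ->.
have half : 2^-1 + 2^-1 = 1 :> C by rewrite [RHS]splitr mul1r.
by rewrite -mulrDl -polyCD half mul1r.
Qed.

(** The spectrum of a real matrix is closed under conjugation and [clip] commutes with conjugation,
    so the assigned polynomial is real and a real gain achieves it. *)
Lemma stabilizable_of_hautus n (A : 'M[R]_n) (B : 'cV[R]_n) :
  hautus (map_mx toC A) (map_mx toC B) -> stabilizable A B.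
Proof.
move=> hAB; have [s As] := char_poly_split (map_mx toC A).
have [F AF] := hautus_assign (s := s) (g := 1) hAB ltac:(by rewrite mul1r).
rewrite mul1r in AF.
have mapJ (t : seq C) (f : C -> C) : map_poly conjc (\prod_(r <- t) ('X - (f r)%:P)) =
    \prod_(r <- t) ('X - (conjc (f r))%:P).
  by rewrite rmorph_prod; apply: eq_bigr => r _; rewrite rmorphB /= map_polyX map_polyC.
have sJ : perm_eq s (map conjc s).
  apply: prod_XsubC_eq; rewrite big_map -(mapJ s id) -As map_char_poly.
  by rewrite map_conj_real.
have chiJ : map_poly conjc (char_poly (map_mx toC A + map_mx toC B *m F)) =
    char_poly (map_mx toC A + map_mx toC B *m F).
  rewrite AF mapJ [RHS](perm_big _ sJ) /= big_map.
  by apply: eq_bigr => r _; rewrite clip_conj.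
exists (map_mx (@complex.Re R) F); apply/schurP => l.
rewrite eigenvalue_root_char (char_poly_real_feedback chiJ) AF.
rewrite -(big_map (@clip) xpredT (fun r => 'X - r%:P)) root_prod_XsubC => /mapP[r _ ->].
by rewrite /clip; case: ifP => // _; rewrite normc0 ltr01.
Qed.

Lemma detectable_of_hautus n (A : 'M[R]_n) (C0 : 'rV[R]_n) :
  hautus (map_mx toC A)^T (map_mx toC C0)^T -> detectable C0 A.
Proof.
rewrite !map_trmx => /stabilizable_of_hautus[F /schurP AF].
exists F^T; apply/schurP => l; rewrite -eigenvalue_tr => lA; apply: AF.
by rewrite map_trmx linearD /= trmx_mul trmxK in lA.
Qed.

End Stabilization.

(** * Polynomials in the shift acting on sequences *)

Section ShiftOperators.
Variable R : realType.
Local Notation C := R[i].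

Lemma vanishes_expanding (l z : C) : 1 <= normc l ->
  vanishes (fun t => l ^+ t * z) -> z = 0.
Proof.
move=> l1 /vanishesP z0; apply: eq0_normc; apply/eqP; rewrite eq_le normc_ge0 andbT.
apply/ler_addgt0Pr => eps /z0[T /(_ T (leqnn T))]; rewrite normcM normcX add0r.
by apply: le_trans; rewrite ler_peMl ?normc_ge0// exprn_ege1.
Qed.

Definition shift_sub (mu : C) (u : nat -> C) := fun t => u t.+1 - mu * u t.

Definition shift_prod (s : seq C) (u : nat -> C) := foldr shift_sub u s.

Lemma shift_sub_prod mu s u : shift_sub mu (shift_prod s u) = shift_prod s (shift_sub mu u).
Proof.
elim: s => //= nu s <-; apply/funext => t; rewrite /shift_sub /=; ring.
Qed.

Lemma vanishes_shift_sub mu u : vanishes u -> vanishes (shift_sub mu u).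
Proof.
move=> u0; rewrite /shift_sub; under eq_fun do rewrite -mulNr.
by apply: vanishesD; [exact: vanishesS | exact: vanishesM].
Qed.

Lemma vanishes_shift_prod s u : vanishes u -> vanishes (shift_prod s u).
Proof. by move=> u0; elim: s => //= mu s; exact: vanishes_shift_sub. Qed.

(** If [normc mu >= 1], a sequence killed by [shift_sub mu] is a multiple of [mu ^+ t]. Since it
    also vanishes at infinity, it is zero, and any factor may replace this one. *)
Lemma shift_prod_clip s u : vanishes u -> shift_prod s u = (fun=> 0) ->
  shift_prod (map (@clip R) s) u = (fun=> 0).
Proof.
elim: s u => //= mu s IH u u0; rewrite shift_sub_prod => /IH.
rewrite -shift_sub_prod => /(_ (vanishes_shift_sub mu u0)) z0.
rewrite /clip; case: ltP => // mu1.
have zS t : shift_prod (map (@clip R) s) u t =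
    mu ^+ t * shift_prod (map (@clip R) s) u 0%N.
  elim: t => [|t IHt]; first by rewrite expr0 mul1r.
  by move: (congr1 (fun f => f t) z0); rewrite /shift_sub => /subr0_eq ->; rewrite IHt mulrA -exprS.
have z00 : shift_prod (map (@clip R) s) u 0%N = 0.
  apply: (vanishes_expanding mu1).
  by under eq_fun do rewrite -zS; exact: vanishes_shift_prod.
by apply/funext => t; rewrite /shift_sub (zS t.+1) (zS t) z00 !mulr0 subr0.
Qed.

Lemma shift_prodB s u v t :
  shift_prod s (fun t => u t - v t) t = shift_prod s u t - shift_prod s v t.
Proof. by elim: s t => //= mu s IH t; rewrite /shift_sub !IH; ring. Qed.

Lemma shift_prod_geometric s (l : C) t :
  shift_prod s (fun t => l ^+ t) t = \prod_(mu <- s) (l - mu) * l ^+ t.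
Proof.
elim: s t => [|mu s IH] t /=; first by rewrite big_nil mul1r.
by rewrite /shift_sub !IH big_cons exprS; ring.
Qed.

(** Each factor looks one step ahead and at most doubles the bound, whence the window
    [T + size s]. *)
Lemma shift_prod_le s (u : nat -> C) (eps : R) :
  (forall mu, mu \in s -> normc mu <= 1) ->
  forall T, (forall t, (t <= T + size s)%N -> normc (u t) <= eps) ->
  forall t, (t <= T)%N -> normc (shift_prod s u t) <= 2 ^+ size s * eps.
Proof.
elim: s => [|mu s IH] s1 T uT t tT /=.
  by rewrite expr0 mul1r uT// (leq_trans tT)// leq_addr.
have {}IH : forall t, (t <= T.+1)%N -> normc (shift_prod s u t) <= 2 ^+ size s * eps.
  apply: IH => [nu nus|x xT]; first by apply: s1; rewrite in_cons nus orbT.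
  by apply: uT; rewrite /= addnS.
apply: le_trans (normcD _ _) _; rewrite normcN normcM exprS -mulrA mulr2n mulrDl mul1r.
apply: lerD; first by rewrite IH.
rewrite -[leRHS]mul1r; apply: ler_pM; rewrite ?normc_ge0//.
  by apply: s1; exact: mem_head.
by rewrite IH// leqW.
Qed.

Lemma shift_prod_matrix n (c : 'rV[C]_n) (M : 'M[C]_n) (w : 'cV[C]_n) s t :
  shift_prod s (fun t => (c *m M ^+ t *m w) 0 0) t =
  (c *m M ^+ t *m (charprod M s *m w)) 0 0.
Proof.
elim: s t => [|mu s IH] t /=; first by rewrite mul1mx.
have subE (U V : 'M[C]_1) : (U - V) 0 0 = U 0 0 - V 0 0 by rewrite !mxE.
have scaleE b (U : 'M[C]_1) : (b *: U) 0 0 = b * U 0 0 by rewrite mxE.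
rewrite /shift_sub !IH -scaleE -subE -[_ *m charprod M s *m w]mulmxA.
congr (fun_of_matrix _ 0 0); move: (charprod M s *m w) => y.
rewrite mulmxBl mulmxBr mul_scalar_mx -scalemxAr; congr (_ - _).
by rewrite exprSr !mulmxA.
Qed.

(* As the sequence vanishes, the roots of its annihilator outside the open unit disc
   may be replaced by 0; the resulting operator has norm at most [2 ^ m]. *)
Lemma vanishing_output_gap m (c : 'rV[C]_m) (M : 'M[C]_m) (w : 'cV[C]_m) (l : C)
    (eps : R) : 1 < normc l ->
  vanishes (fun t => (c *m M ^+ t *m w) 0 0) ->
  (forall t, (t <= m)%N -> normc ((c *m M ^+ t *m w) 0 0 - l ^+ t) <= eps) ->
  (normc l - 1) ^+ m <= 2 ^+ m * eps.
Proof.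
move=> l1 u0 ul; have [s Ms] := char_poly_split M.
have sz : size s = m.
  by have := size_char_poly M; rewrite Ms size_prod_XsubC => -[].
set u := fun t => (c *m M ^+ t *m w) 0 0 in u0 ul.
have us : shift_prod (map (@clip R) s) u = (fun=> 0).
  apply: (shift_prod_clip u0); apply/funext => t.
  by rewrite shift_prod_matrix (charprod_eq0 Ms) mul0mx mulmx0 mxE.
have clip1 mu : mu \in map (@clip R) s -> normc mu <= 1.
  move=> /mapP[nu _ ->]; rewrite /clip; case: ifP => [/ltW//|_].
  by rewrite normc0.
(* At time 0 the operator kills [u] and multiplies the geometric sequence by the product of the
   [l - mu], each of modulus at least [normc l - 1]. *)
have := @shift_prod_le (map (@clip R) s) (fun t => u t - l ^+ t) eps clip1 0%N.
rewrite size_map sz => /(_ ul 0%N (leqnn _)); apply: le_trans.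
rewrite shift_prodB us shift_prod_geometric expr0 mulr1 sub0r normcN.
rewrite -sz -(size_map (@clip R) s).
elim: (map (@clip R) s) clip1 => [|mu r IH] r1; first by rewrite big_nil expr0 normc1.
rewrite big_cons normcM exprS; apply: ler_pM.
- by rewrite subr_ge0 ltW.
- by rewrite exprn_ge0// subr_ge0 ltW.
- rewrite lerBlDr; have mu1 := r1 mu (mem_head _ _).
  rewrite -{1}(subrK mu l); apply: le_trans (normcD _ _) _.
  by rewrite lerD2l.
- by apply: IH => nu nur; apply: r1; rewrite in_cons nur orbT.
Qed.

Definition mx_norm1 m n (Q : 'M[C]_(m, n)) : R := \sum_i \sum_j normc (Q i j).

Lemma mx_norm1_ge0 m n (Q : 'M[C]_(m, n)) : 0 <= mx_norm1 Q.
Proof. by rewrite sumr_ge0// => i _; rewrite sumr_ge0// => j _; exact: normc_ge0. Qed.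

Lemma entry_le_mx_norm1 m n (Q : 'M[C]_(m, n)) i j : normc (Q i j) <= mx_norm1 Q.
Proof.
rewrite /mx_norm1 (bigD1 i)//= (bigD1 j)//= -addrA lerDl addr_ge0// sumr_ge0// => k _.
  exact: normc_ge0.
by rewrite sumr_ge0// => ? _; exact: normc_ge0.
Qed.

Lemma mulmx_entry_le m n (Q : 'M[C]_(m, n)) (r : 'cV[C]_n) (b : R) : 0 <= b ->
  (forall j, normc (r j 0) <= b) -> forall i, normc ((Q *m r) i 0) <= mx_norm1 Q * b.
Proof.
move=> b0 rb i; rewrite mxE; apply: le_trans (le_normc_sum _) _.
rewrite /mx_norm1 (bigD1 i)//= mulrDl mulr_suml; apply: (@le_trans _ _ (\sum_j normc (Q i j) * b)).
  by apply: ler_sum => j _; rewrite normcM ler_wpM2l ?normc_ge0.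
by rewrite lerDl mulr_ge0// sumr_ge0// => k _; rewrite sumr_ge0// => j _; exact: normc_ge0.
Qed.

(** The error [r] evolves by [M0 r + d M1 (r + l ^+ t w)], so a bound linear in [d] propagates. The
    constant may depend on [t] but not on [d]. *)
Lemma perturbed_power m (M0 M1 : 'M[C]_m) (w : 'cV[C]_m) (l : C) :
  M0 *m w = l *: w ->
  forall t, exists2 K : R, 0 <= K & forall d : R, 0 <= d <= 1 -> forall i,
    normc (((M0 + real_complex R d *: M1) ^+ t *m w - l ^+ t *: w) i 0) <= K * d.
Proof.
move=> M0w; elim=> [|t [K K0 IH]].
  exists 0 => // d _ i; rewrite !expr0 mul1mx scale1r subrr mxE normc0 mul0r//.
pose b := mx_norm1 (l ^+ t *: w).
exists (mx_norm1 M0 * K + mx_norm1 M1 * (K + b)).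
  by rewrite addr_ge0// mulr_ge0 ?addr_ge0 ?mx_norm1_ge0.
move=> d d01 i; set M := M0 + _; set r := M ^+ t *m w - l ^+ t *: w.
have rE : M ^+ t.+1 *m w - l ^+ t.+1 *: w =
    M0 *m r + real_complex R d *: (M1 *m (r + l ^+ t *: w)).
  rewrite subrK exprS -mulmxA {1}/M mulmxDl mulmxBr -scalemxAl.
  by rewrite -[M0 *m (_ *: w)]scalemxAr M0w scalerA -exprSr addrAC.
have addE (U V : 'cV[C]_m) k : (U + V) k 0 = U k 0 + V k 0 by rewrite mxE.
have scaleE c (U : 'cV[C]_m) k : (c *: U) k 0 = c * U k 0 by rewrite mxE.
rewrite rE addE scaleE; apply: le_trans (normcD _ _) _.
rewrite mulrDl; apply: lerD.
  rewrite -mulrA; apply: mulmx_entry_le => [|j]; last exact: IH.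
  by case/andP: d01 => d0 _; rewrite mulr_ge0.
case/andP: (d01) => d0 d1; rewrite normcM normc_real ger0_norm// mulrC ler_wpM2r//.
apply: mulmx_entry_le => [|j]; first by rewrite addr_ge0 ?mx_norm1_ge0.
rewrite addE; apply: le_trans (normcD _ _) _.
apply: lerD; last exact: entry_le_mx_norm1.
by apply: le_trans (IH d d01 j) _; rewrite ler_piMr.
Qed.

End ShiftOperators.

(** * Necessary conditions from two-agent networks *)

Section Necessity.
Variable R : realType.
Local Notation toC := (real_complex R).
Variables (n nc m : nat).
Variables (A : 'M[R]_n) (B : 'M[R]_(n, 1)) (C : 'M[R]_(1, n)).
Variables (Ac : 'M[R]_nc) (Bc : 'M[R]_(nc, 1)) (Ec : 'M[R]_(nc, m)).
Variables (Fc : 'M[R]_(1, nc)) (G1 : 'M[R]_1) (G2 : 'M[R]_(1, m)) (Hc : 'M[R]_(m, nc)).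

Let M0 : 'M[R]_(n + nc) := block_mx A (B *m Fc) 0 Ac.
Let M1 : 'M[R]_(n + nc) :=
  block_mx (B *m G1 *m C) (B *m G2 *m Hc) (Bc *m C) (Ec *m Hc).

(* Dynamics of the difference between a leader and its only follower, when the
   latter is coupled to the leader with gain [d]. *)
Definition follower_mx (d : R) : 'M[R]_(n + nc) := M0 + d *: M1.

Hypothesis sync : forall (N : nat) (a : 'M[R]_N) (q : 'I_N -> R),
  weighted_adj a -> has_spanning_tree a -> indegree_bound a q ->
  forall (x : nat -> 'I_N -> 'cV[R]_n) (xc : nat -> 'I_N -> 'cV[R]_nc),
    closed_loop A B C Ac Bc Ec Fc G1 G2 Hc a q x xc -> synchronized x.

Lemma follower_cvg0 (d : R) (w : 'cV[R]_(n + nc)) k : 0 < d <= 2^-1 ->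
  (fun t => usubmx (follower_mx d ^+ t *m w) k 0) @ \oo --> (0 : R).
Proof.
move=> /andP[d0 d1].
(* Node 0 leads and stays at rest, so the follower's state is itself the difference. With edge
   weight 1, taking [q = d^-1 - 1] gives gain [d], and [d <= 2^-1] makes [q] at least the in-degree
   1. *)
pose a : 'M[R]_2 := \matrix_(i, j) ((i != 0) && (j == 0))%:R.
pose q (i : 'I_2) := d^-1 - 1.
pose z t := follower_mx d ^+ t *m w.
pose x (t : nat) (i : 'I_2) : 'cV[R]_n := if i == 0 then 0 else usubmx (z t).
pose xc (t : nat) (i : 'I_2) : 'cV[R]_nc := if i == 0 then 0 else dsubmx (z t).
have dE p i (f : 'I_2 -> 'cV[R]_p) : \sum_(j | j != i) dcoef a q i j *: f j =
    if i == 0 then 0 else d *: f 0.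
  have [->|i0] := eqVneq i 0.
    by rewrite big1// => j _; rewrite /dcoef mxE eqxx mul0r scale0r.
  rewrite (bigD1 0) 1?eq_sym//= big1 ?addr0 => [|j /andP[_ j0]].
    by rewrite /dcoef mxE i0 eqxx /q addrC subrK invrK mul1r.
  by rewrite /dcoef mxE (negPf j0) andbF mul0r scale0r.
have zS t : z t.+1 = follower_mx d *m z t by rewrite /z exprS mulmxA.
have aw : weighted_adj a.
  split=> [i j|i]; first by rewrite mxE ler0n.
  by rewrite mxE andNb.
have ar : has_spanning_tree a.
  exists 0 => i; have [->|i0] := eqVneq i 0; first exact: connect0.
  by apply: connect1; rewrite mxE i0 eqxx ltr01.
have aq : indegree_bound a q.
  move=> i; rewrite (bigD1 0)//= big1 => [|j j0]; last by rewrite mxE (negPf j0) andbF.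
  rewrite addr0 mxE eqxx andbT /q; apply: (@le_trans _ _ 1); first by rewrite lern1 leq_b1.
  rewrite lerBrDr -(@invrK _ (1 + 1)) lef_pV2 ?posrE ?invr_gt0//.
have loop : closed_loop A B C Ac Bc Ec Fc G1 G2 Hc a q x xc.
  move=> t i /=; rewrite !dE /x /xc eqxx.
  have [i0|i0] := eqVneq i 0; first by split; rewrite !(mulmx0, addr0).
  set u := usubmx (z t); set v := dsubmx (z t); rewrite !subr0 mulmx0 subr0.
  have -> : z t.+1 = col_mx (A *m u + B *m Fc *m v + d *: (B *m G1 *m C *m u + B *m G2 *m Hc *m v))
                            (Ac *m v + d *: (Bc *m C *m u + Ec *m Hc *m v)).
    rewrite zS -[z t]vsubmxK /follower_mx mulmxDl -scalemxAl !mul_block_col.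
    by rewrite mul0mx add0r scale_col_mx add_col_mx.
  rewrite col_mxKu col_mxKd !mulmxDr -!scalemxAr -!mulmxA !scalerDr !addrA.
  by [].
have := sync aw ar aq loop 1 0 k.
by under eq_fun do rewrite /x eqxx /= subr0.
Qed.

Lemma map_mxX p (M : 'M[R]_p) t : map_mx toC (M ^+ t) = map_mx toC M ^+ t.
Proof.
elim: t => [|t IH]; first by rewrite !expr0 map_mx1.
by rewrite !exprS map_mxM IH.
Qed.

Lemma follower_vanishes d : 0 < d <= 2^-1 ->
  mx_vanishes (fun t => usubmx (map_mx toC (follower_mx d) ^+ t)).
Proof.
move=> d01 i j; have := follower_cvg0 (delta_mx j 0) i d01.
under eq_fun do rewrite -mul_usub_mx -colE mxE.
move=> /vanishes_real; congr vanishes; apply/funext => t.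
by rewrite -map_mxX -map_usubmx [RHS]mxE.
Qed.

Let half_ok : 0 < (2^-1 : R) <= 2^-1.
Proof. by rewrite lexx invr_gt0 ltr0n. Qed.

(** The protocol acts on [x] only through [B], so a left eigenvector of [A] annihilating [B], padded
    by zero, is one of the follower matrix. Its component evolves as [l ^+ t] and cannot vanish. *)
Lemma follower_stabilizable : stabilizable A B.
Proof.
apply: stabilizable_of_hautus => l p l1 pA pB.
set M := map_mx toC (follower_mx 2^-1).
have pM : row_mx p 0 *m M = l *: row_mx p 0.
  rewrite /M /follower_mx map_mxD map_mxZ !map_block_mx mulmxDr -scalemxAr.
  rewrite !mul_row_block !mul0mx !addr0 !map_mxM !mulmxA pA pB !mul0mx.
  by rewrite row_mx0 scaler0 addr0 scale_row_mx scaler0.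
have pMt t : p *m usubmx (M ^+ t) = l ^+ t *: row_mx p 0.
  have -> : p *m usubmx (M ^+ t) = row_mx p 0 *m M ^+ t.
    by rewrite -[X in _ = _ *m X]vsubmxK mul_row_col mul0mx addr0.
  elim: t => [|t IH]; first by rewrite !expr0 mulmx1 scale1r.
  by rewrite exprSr mulmxA IH -scalemxAl pM scalerA -exprSr.
apply/rowP => k; rewrite [RHS]mxE; apply: (vanishes_expanding l1).
have := mx_vanishesMl p (follower_vanishes half_ok) 0 (lshift nc k).
by congr vanishes; apply/funext => t; rewrite -/M pMt mxE row_mxEl.
Qed.

(** From an unobservable eigenvector and a zero protocol state, the protocol is never excited and
    the state evolves as [l ^+ t]. *)
Lemma follower_detectable : detectable C A.
Proof.
apply: detectable_of_hautus => l p l1 pA pC.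
set v := p^T; set M := map_mx toC (follower_mx 2^-1).
have Av : map_mx toC A *m v = l *: v by rewrite -[LHS]trmxK trmx_mul trmxK pA linearZ.
have Cv : map_mx toC C *m v = 0 by rewrite -[LHS]trmxK trmx_mul trmxK pC trmx0.
have Mv : M *m col_mx v 0 = l *: col_mx v 0.
  rewrite /M /follower_mx map_mxD map_mxZ !map_block_mx mulmxDl -scalemxAl.
  rewrite !mul_block_col !mulmx0 !addr0 !map_mxM -!mulmxA Av Cv !mulmx0 map_mx0 mul0mx.
  by rewrite col_mx0 scaler0 addr0 scale_col_mx scaler0.
have Mvt t : usubmx (M ^+ t) *m col_mx v 0 = l ^+ t *: v.
  rewrite mul_usub_mx; suff -> : M ^+ t *m col_mx v 0 = l ^+ t *: col_mx v 0.
    by rewrite scale_col_mx col_mxKu.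
  elim: t => [|t IH]; first by rewrite !expr0 mul1mx scale1r.
  by rewrite exprS -mulmxA IH -scalemxAr Mv scalerA -exprSr.
suff v0 : v = 0 by rewrite -[p]trmxK -/v v0 trmx0.
apply/colP => k; rewrite [RHS]mxE; apply: (vanishes_expanding l1).
have := mx_vanishesMr (col_mx v 0) (follower_vanishes half_ok) k 0.
by congr vanishes; apply/funext => t; rewrite -/M Mvt mxE.
Qed.

(* As [d] tends to 0, the output of the follower from an eigenvector of [A]
   tends pointwise to the geometric sequence of its eigenvalue. *)
Lemma follower_closed_disc : eig_closed_disc A.
Proof.
apply/eig_closed_discP => l; rewrite -eigenvalue_tr => /eigenvalueP[p pA p0].
rewrite leNgt; apply/negP => l1.
have /rV0Pn[k pk] := p0.
(* Normalised so that coordinate [k], read off by [c], is exactly [l ^+ t] when [d = 0]. *)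
pose v := (p 0 k)^-1 *: p^T.
have Av : map_mx toC A *m v = l *: v.
  rewrite -scalemxAr scalerA mulrC -scalerA; congr (_ *: _).
  by rewrite -[LHS]trmxK trmx_mul trmxK pA linearZ.
have vk : v k 0 = 1 by rewrite !mxE mulVf.
pose w : 'cV[R[i]]_(n + nc) := col_mx v 0.
pose c : 'rV[R[i]]_(n + nc) := delta_mx 0 (lshift nc k).
have M0w : map_mx toC M0 *m w = l *: w.
  rewrite map_block_mx mul_block_col !mulmx0 !addr0 Av map_mx0 mul0mx.
  by rewrite scale_col_mx scaler0.
have cE (u : 'cV[R[i]]_(n + nc)) : (c *m u) 0 0 = u (lshift nc k) 0.
  by rewrite -rowE mxE.
have [K Kp] := choice (fun t => match perturbed_power (map_mx toC M1) M0w t with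
  ex_intro2 K K0 KP => ex_intro _ K (conj K0 KP) end).
(* The annihilating polynomial has degree [D] for every [d], so only times up to [D] matter and
   summing the [K t] gives one constant. *)
pose D := (n + nc)%N; pose KD := \sum_(t < D.+1) K t.
have KD0 : 0 <= KD by rewrite sumr_ge0// => t _; case: (Kp t).
have gap d : 0 < d <= 2^-1 -> (normc l - 1) ^+ D <= 2 ^+ D * (KD * d).
  move=> d01; have /andP[d0 d1] := d01.
  apply: (@vanishing_output_gap _ _ c (map_mx toC (follower_mx d)) w) => //.
    have := mx_vanishesMr w (follower_vanishes d01) k 0.
    congr vanishes; apply/funext => t.
    by rewrite -mulmxA cE mul_usub_mx mxE.
  move=> t tD; have -> : map_mx toC (follower_mx d) = map_mx toC M0 + toC d *: map_mx toC M1.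
    by rewrite map_mxD map_mxZ.
  have [_ /(_ d _ (lshift nc k))] := Kp t; rewrite ltW//= => KP.
  have -> : (c *m (map_mx toC M0 + toC d *: map_mx toC M1) ^+ t *m w) 0 0 - l ^+ t =
      ((map_mx toC M0 + toC d *: map_mx toC M1) ^+ t *m w - l ^+ t *: w) (lshift nc k) 0.
    have subE (U V : 'cV[R[i]]_(n + nc)) j : (U - V) j 0 = U j 0 - V j 0 by rewrite !mxE.
    by rewrite subE -mulmxA cE [(_ *: w) _ _]mxE [w _ _]col_mxEu vk mulr1.
  apply: le_trans (KP _) _; first by lra.
  rewrite ler_wpM2r ?(ltW d0)// /KD (bigD1 (Ordinal (leq_ltn_trans tD (ltnSn D))))//=.
  by rewrite lerDl sumr_ge0// => j _; case: (Kp j).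
have gap0 : 0 < (normc l - 1) ^+ D by rewrite exprn_gt0// subr_gt0.
pose b := 2 ^+ D * KD; have b0 : 0 <= b by rewrite mulr_ge0// exprn_ge0.
set g := (normc l - 1) ^+ D in gap gap0.
(* Small enough that [b * d < g], contradicting [gap]; the [+ 1] covers [b = 0]. *)
pose d := Num.min 2^-1 (g / (2 * (b + 1))).
have b1 : 0 < 2 * (b + 1) by lra.
have d01 : 0 < d <= 2^-1.
  by rewrite lt_min ge_min lexx invr_gt0 ltr0n divr_gt0.
have dg : d * (2 * (b + 1)) <= g.
  by rewrite -ler_pdivlMr// ge_min lexx orbT.
by have := gap d d01; rewrite mulrA -/b; case/andP: d01 => d0 _; nra.
Qed.

End Necessity.

Theorem theorem7 (R : realType) (n : nat)
  (A : 'M[R]_n) (B : 'M[R]_(n, 1)) (C : 'M[R]_(1, n)) :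
  sf_collab_solvable A B C <->
  (schur A \/ (stabilizable A B /\ detectable C A /\ eig_closed_disc A)).
Proof.
split=> [[nc [m [Ac [Bc [Ec [Fc [G1 [G2 [Hc sync]]]]]]]]]|[As|[AB [CA A1]]]].
- right; split; first exact: (follower_stabilizable sync).
  split; first exact: (follower_detectable sync).
  exact: (follower_closed_disc sync).
(* For a Schur [A], zero gains already witness stabilizability and detectability. *)
- apply: solvable_of_stabilizable_detectable.
  + by exists 0; rewrite mulmx0 addr0.
  + by exists 0; rewrite mul0mx addr0.
  + by move=> l /As/ltW.
- exact: solvable_of_stabilizable_detectable.
Qed.
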